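(* Let $F(X)$ be the free group over a finite set $X$, and let $S$ be a finitely generated subgroup of $F(X)$. Then $S$ is a $\mathbf{VPL}^\forall$ set if and only if $S$ has finite index in $F(X)$ (and hence, in this case, $S$ is recognisable).
   Context: Notation: $\Sigma = X\cup X^{-1}$ is the alphabet containing for each $x\in X$ two distinct formal symbols $x,x^{-1}$, and $\pi:\Sigma^\star\to F(X)$ is the monoid homomorphism sending each letter to the corresponding group element. A set $S\subseteq F(X)$ is $\mathbf{VPL}^\forall$ if $\pi^{-1}(S)\subseteq\Sigma^\star$ is a visibly pushdown language, and recognisable if $\pi^{-1}(S)$ is a regular language. Visibly pushdown automaton (VPA): a pushdown automaton (finite set of states, initial state(s), set of accepting states, stack alphabet $\Gamma$ with a distinguished bottom-of-stack symbol $\bot\in\Gamma$, initial stack $\bot$) over $\Sigma$ without $\varepsilon$-transitions, for which there is a partition $\Sigma=\Sigma_c\sqcup\Sigma_i\sqcup\Sigma_r$ (calls, internals, responses; parts may be empty) such that: on reading a letter of $\Sigma_i$ the transition neither depends on nor modifies the stack; on reading a letter of $\Sigma_c$ the transition does not depend on the stack and pushes exactly one symbol, different from $\bot$; on reading a letter of $\Sigma_r$ the transition reads the topmost stack symbol and pops it, pushing nothing (if the topmost symbol is $\bot$, it is read but not removed). A word is accepted if the automaton can be in an accepting state after reading it, with no condition on the stack. (Deterministic and nondeterministic VPAs accept the same languages.) A language over $\Sigma$ is a visibly pushdown language if it is accepted by a VPA for some partition of $\Sigma$. *)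

(* Defs.v *)
From HB Require Import structures.
From mathcomp Require Import all_boot boolp classical_sets cardinality.

Set Implicit Arguments.
Unset Strict Implicit.
Unset Printing Implicit Defensive.

Local Open Scope classical_set_scope.
Local Open Scope group_scope.

(* (x, true) stands for the formal symbol x and (x, false) for x^-1. *)
Definition letter (X : Type) : Type := (X * bool)%type.

Definition inv_letter (X : Type) (a : letter X) : letter X := (a.1, ~~ a.2).

Lemma inv_letterK (X : Type) : involutive (@inv_letter X).
Proof. by case=> x b; rewrite /inv_letter /= negbK. Qed.

Section FreeGroup.
Variable X : choiceType.
Implicit Types (a b : letter X) (u v w : seq (letter X)).

Definition reduced w : bool := sorted (fun a b => b != inv_letter a) w.

Record free_group : Type := FreeGroup {
  fg_word : seq (letter X);
  fg_reduced : reduced fg_word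
}.

HB.instance Definition _ := [isSub for fg_word].
HB.instance Definition _ := [Choice of free_group by <:].

(* The reduced form of a w, when w is reduced. *)
Definition reduce_cons a w : seq (letter X) :=
  if w is b :: w' then if b == inv_letter a then w' else a :: w else [:: a].

(* The reduced form of u v, when v is reduced. *)
Definition reduce_cat u v : seq (letter X) := foldr reduce_cons v u.

Lemma reduced_cons a w : reduced w -> reduced (reduce_cons a w).
Proof.
case: w => [|b w] //= rw; case: ifP => [_|ne]; first exact: path_sorted rw.
by rewrite /= ne rw.
Qed.

Lemma reduced_cat u v : reduced v -> reduced (reduce_cat u v).
Proof. by move=> rv; elim: u => //= a u IH; apply: reduced_cons. Qed.

Lemma reduce_cons_id a w : reduced (a :: w) -> reduce_cons a w = a :: w.
Proof. by case: w => //= b w /andP[/negbTE->]. Qed.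

Lemma reduce_consK a w :
  reduced w -> reduce_cons (inv_letter a) (reduce_cons a w) = w.
Proof.
case: w => [|b w] rw; first by rewrite /= inv_letterK eqxx.
rewrite {2}/reduce_cons; have [eb|ne] := eqVneq b (inv_letter a).
  by rewrite -eb reduce_cons_id.
by rewrite /= inv_letterK eqxx.
Qed.

Lemma reduce_catA u v w : reduced w ->
  reduce_cat u (reduce_cat v w) = reduce_cat (reduce_cat u v) w.
Proof.
move=> rw; elim: u => //= a u ->; move: (reduce_cat u v) => [|b t] //=.
have [->|//] := eqVneq b (inv_letter a).
by rewrite -[in X in reduce_cons X _](inv_letterK a) reduce_consK // reduced_cat.
Qed.

Lemma reduce_cats0 u : reduced u -> reduce_cat u [::] = u.
Proof.
elim: u => //= a u IH ru; rewrite IH; last exact: path_sorted ru.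
exact: reduce_cons_id.
Qed.

Definition inv_word w : seq (letter X) := rev (map (@inv_letter X) w).

Lemma inv_wordK : involutive inv_word.
Proof.
by move=> w; rewrite /inv_word map_rev revK (mapK (@inv_letterK X)).
Qed.

Lemma reduced_inv w : reduced w -> reduced (inv_word w).
Proof.
rewrite /reduced /inv_word rev_sorted sorted_map.
apply: sub_sorted => a b /=.
by apply: contra => /eqP /(can_inj (@inv_letterK X)) ->; rewrite inv_letterK.
Qed.

Lemma reduce_catV w : reduced w -> reduce_cat (inv_word w) w = [::].
Proof.
elim: w => //= a w IH rw.
rewrite /inv_word /= rev_cons /reduce_cat foldr_rcons /= inv_letterK eqxx.
by apply: IH; apply: path_sorted rw.
Qed.

Definition fg_one : free_group := @FreeGroup [::] isT.
Definition fg_mul (g h : free_group) : free_group :=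
  FreeGroup (reduced_cat (fg_word g) (fg_reduced h)).
Definition fg_inv (g : free_group) : free_group :=
  FreeGroup (reduced_inv (fg_reduced g)).

Fact fg_mulA : associative fg_mul.
Proof.
by move=> g h k; apply: val_inj; rewrite /= reduce_catA ?fg_reduced.
Qed.
Fact fg_mul1 : left_id fg_one fg_mul.
Proof. by move=> g; apply: val_inj. Qed.
Fact fg_mulr1 : right_id fg_one fg_mul.
Proof. by move=> g; apply: val_inj; apply: reduce_cats0 (fg_reduced g). Qed.
Fact fg_mulV : left_inverse fg_one fg_inv fg_mul.
Proof. by move=> g; apply: val_inj; apply: reduce_catV (fg_reduced g). Qed.
Fact fg_mulrV : right_inverse fg_one fg_inv fg_mul.
Proof.
move=> g; apply: val_inj; rewrite /= -{1}[fg_word g]inv_wordK.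
exact: reduce_catV (reduced_inv (fg_reduced g)).
Qed.

HB.instance Definition _ :=
  isGroup.Build free_group fg_mulA fg_mul1 fg_mulr1 fg_mulV fg_mulrV.

Definition fg_gen (x : X) : free_group := @FreeGroup [:: (x, true)] isT.

Definition letter_eval a : free_group :=
  if a.2 then fg_gen a.1 else (fg_gen a.1)^-1.

Definition word_eval w : free_group := \prod_(a <- w) letter_eval a.

End FreeGroup.

Section Subgroups.
Variable G : groupType.
Implicit Types S gens : set G.

Definition is_subgroup S : Prop :=
  [/\ S 1, forall g h, S g -> S h -> S (g * h) & forall g, S g -> S g^-1].

Definition finitely_generated S : Prop :=
  exists2 gens, finite_set gens & S = smallest is_subgroup gens.

Definition left_coset (g : G) S : set G := [set g * s | s in S].

Definition finite_index S : Prop :=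
  finite_set [set left_coset g S | g in [set: G]].

End Subgroups.

Definition language (A : Type) : Type := set (seq A).

Definition regular (A : Type) (L : language A) : Prop :=
  exists (Q : finType) (q0 : Q) (F : {set Q}) (delta : Q -> A -> Q),
    forall w, L w <-> foldl delta q0 w \in F.

(* Pushdown automata without epsilon-transitions, accepting by final state.
   (q', u) \in trans q a c means that in state q, reading a with c on top of
   the stack, the automaton may go to q' and replace c by the string u, whose
   first symbol becomes the topmost one. *)
Record pda (A : Type) : Type := Pda {
  pda_state : finType;
  pda_stack : finType;
  pda_bot : pda_stack;
  pda_init : {set pda_state};
  pda_final : {set pda_state};
  pda_trans :
    pda_state -> A -> pda_stack -> seq (pda_state * seq pda_stack)
}.

Section PushdownAutomata.
Variable A : Type.

Definition pda_config (M : pda A) : Type :=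
  (pda_state M * seq (pda_stack M))%type.

Inductive pda_step (M : pda A) (a : A) : pda_config M -> pda_config M -> Prop :=
  PdaStep q c s q' u of (q', u) \in pda_trans q a c :
    pda_step a (q, c :: s) (q', u ++ s).

Fixpoint pda_run (M : pda A) (c : pda_config M) (w : seq A)
    (d : pda_config M) : Prop :=
  if w is a :: w' then exists2 c', pda_step a c c' & pda_run c' w' d
  else c = d.

Definition pda_language (M : pda A) : language A :=
  [set w | exists q0 q s, [/\ q0 \in pda_init M, q \in pda_final M
    & pda_run (q0, [:: pda_bot M]) w (q, s)]].

Inductive letter_kind : Type := Call | Internal | Response.

(* A partition of the alphabet into three possibly empty parts is given by the
   function sending a letter to its part. *)
Definition is_vpa (kind : A -> letter_kind) (M : pda A) : Prop :=
  forall (q : pda_state M) (a : A),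
    match kind a with
    | Internal => exists R : seq (pda_state M),
        forall c, pda_trans q a c =i [seq (q', [:: c]) | q' <- R]
    | Call => exists2 R : seq (pda_state M * pda_stack M),
        forall p, p \in R -> p.2 != pda_bot M
        & forall c, pda_trans q a c =i [seq (p.1, [:: p.2; c]) | p <- R]
    | Response => forall c, exists R : seq (pda_state M),
        pda_trans q a c
          =i [seq (q', if c == pda_bot M then [:: c] else [::]) | q' <- R]
    end.

Definition visibly_pushdown (L : language A) : Prop :=
  exists (kind : A -> letter_kind) (M : pda A),
    is_vpa kind M /\ L = pda_language M.

End PushdownAutomata.

Definition vpl_forall (X : finType) (S : set (free_group X)) : Prop :=
  visibly_pushdown (@word_eval X @^-1` S).

Definition recognisable (X : finType) (S : set (free_group X)) : Prop :=
  regular (@word_eval X @^-1` S).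

(* Main.v *)
Require Import Defs.
From mathcomp Require Import all_boot.
From mathcomp Require Import boolp classical_sets cardinality.

(* If S has finite index, its cosets are the states of a finite automaton.

   Conversely, let a VPA accept the words representing elements of S. For every
   word p and generator x, let a be one of x, x^-1, chosen so that if a is a call
   then so is its inverse. On the accepted words p a^n a^-n p^-1, what the automaton
   remembers of p a^n takes finitely many values, so by pigeonhole it also accepts
   p a^m a^-n p^-1 for some m <> n. Hence x has only finite orbits on the cosets
   of S. When S is finitely generated, the cosets tS with t a suffix of a
   generator form a finite set V, and all suffixes of a reduced word representing
   an element of S stay in V. Suppose that a letter a leads from tS in V outside V;
   stripping leading a's from t, we may assume that neither a nor a^-1 is the
   first letter of t. The a-orbit of tS is finite, so some reduced word t^-1 a^n t
   lies in S, and its suffixes keep the whole orbit in V, a contradiction. So V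
   consists of all cosets. *)

Set Implicit Arguments.
Unset Strict Implicit.
Unset Printing Implicit Defensive.

Local Open Scope classical_set_scope.
Local Open Scope group_scope.

Lemma nat_fin_collision (Q : finType) (f : nat -> Q) :
  exists i j, (i < j)%N /\ f i = f j.
Proof.
have /injectivePn[i [j ne eqf]] : ~~ injectiveb (fun i : 'I_#|Q|.+1 => f i).
  by apply/injectiveP => /leq_card; rewrite card_ord ltnn.
by case: (ltngtP i j) ne => [lt _|lt _|/val_inj-> /eqP//];
  [exists i, j|exists j, i].
Qed.

(** * Pumping in visibly pushdown automata *)

Section Pumping.
Variables (A : Type) (kind : A -> letter_kind) (M : pda A).
Hypothesis vpaM : is_vpa kind M.
Implicit Types (q : pda_state M) (c : pda_stack M) (s t u : seq (pda_stack M)).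
Implicit Types (w r p : seq A) (a b : A).

Lemma pda_run_cat (d e : pda_config M) w r :
  pda_run d (w ++ r) e <-> exists2 d', pda_run d w d' & pda_run d' r e.
Proof.
elim: w d => [|a w IH] d /=; first by split=> [|[d' ->]//]; exists d.
split=> [[d1 d1P /IH[d' wd' rd']]|[d' [d1 d1P wd'] rd']].
  by exists d' => //; exists d1.
by exists d1 => //; apply/IH; exists d'.
Qed.

Lemma pda_stepE a q s (d : pda_config M) : pda_step a (q, s) d ->
  exists c s' q' u, [/\ s = c :: s', (q', u) \in pda_trans q a c
    & d = (q', u ++ s')].
Proof.
move E: (q, s) => e de; case: de E => q1 c s1 q' u tr [-> ->].
by exists c, s1, q', u.
Qed.

Lemma pda_run_stack_prefix w q u s q' t :
  (size w <= size u)%N -> pda_run (q, u ++ s) w (q', t) ->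
  exists u', forall s', pda_run (q, u ++ s') w (q', u' ++ s').
Proof.
elim: w q u => [|a w IH] q u /=.
  by move=> _ [-> _]; exists u.
case: u => [//|c u] /= lewu [d /pda_stepE[_ [_ [q2 [v [[<- <-] tr ->]]]]]].
rewrite catA => /IH[|u' u'P]; first last.
  exists u' => s'; exists (q2, v ++ u ++ s'); first exact: PdaStep.
  by rewrite catA.
by rewrite size_cat (leq_trans (lewu : (size w <= size u)%N)) ?leq_addl.
Qed.

Lemma vpa_step_size a q s q' t : pda_step a (q, s) (q', t) ->
  (size t <= size s + (if kind a is Call then 1 else 0))%N.
Proof.
move=> /pda_stepE[c [s' [q1 [u [-> tr [_ ->]]]]]]; have := vpaM q a.
case: (kind a) => [[R _ RE]|[R RE]|/(_ c)[R RE]].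
- by move: tr; rewrite RE => /mapP[p _ [_ ->]]; rewrite /= addn1.
- by move: tr; rewrite RE => /mapP[p _ [_ ->]]; rewrite /= addn0.
- move: tr; rewrite RE => /mapP[p _ [_ ->]]; rewrite addn0.
  by case: ifP => _ /=.
Qed.

Lemma vpa_run_size w q s q' t : pda_run (q, s) w (q', t) ->
  (size t <= size s + size w)%N.
Proof.
elim: w q s => [|a w IH] q s /=; first by move=> [_ ->]; rewrite addn0.
move=> [[q1 s1] /vpa_step_size les1 /IH/leq_trans->//].
rewrite addnS -addSn leq_add2r (leq_trans les1) // -[(size s).+1]addn1 leq_add2l.
by case: (kind a).
Qed.

Lemma vpa_run_size_noncall n a q s q' t : kind a <> Call ->
  pda_run (q, s) (nseq n a) (q', t) -> (size t <= size s)%N.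
Proof.
move=> nca; elim: n q s => [|n IH] q s /=; first by move=> [_ ->].
move=> [[q1 s1] /vpa_step_size les1 /IH/leq_trans->//].
by case: (kind a) nca les1 => // _; rewrite addn0.
Qed.

(** Calls do not depend on the stack, so the run transfers to any other stack. That stack must be
    nonempty because [pda_step] needs a topmost symbol. *)
Lemma vpa_run_calls n b q s q' t : kind b = Call ->
  pda_run (q, s) (nseq n.+1 b) (q', t) ->
  exists2 u, size u = n.+1 &
    t = u ++ s /\ forall s', (0 < size s')%N ->
      pda_run (q, s') (nseq n.+1 b) (q', u ++ s').
Proof.
move=> kb.
have step q1 s1 q2 s2 : pda_step b (q1, s1) (q2, s2) -> exists g,
    s2 = g :: s1 /\ forall s', (0 < size s')%N -> pda_step b (q1, s') (q2, g :: s').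
  move=> /pda_stepE[c [s' [q3 [u [-> tr [-> ->]]]]]].
  have := vpaM q1 b; rewrite kb => -[R _ RE].
  move: tr; rewrite RE => /mapP[[q4 g] Rp [-> ->]]; exists g; split=> // -[//|c' s3] _.
  have tr' : (q4, [:: g; c']) \in pda_trans q1 b c'.
    by rewrite RE; apply/mapP; exists (q4, g).
  exact: (PdaStep s3 tr').
elim: n q s => [|n IH] q s /= [[q1 s1] /step[g [-> gP]]].
  move=> [<- <-]; exists [:: g] => //; split=> // s' s'0.
  by exists (q1, g :: s'); first exact: gP.
move=> /IH[u szu [-> uP]]; exists (rcons u g); first by rewrite size_rcons szu.
rewrite cat_rcons; split=> // s' s'0; exists (q1, g :: s'); first exact: gP.
by rewrite cat_rcons; apply: uP.
Qed.

(* For a call b, a return word r shorter than the block of b's only pops what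
   this block pushed, so just the state after p a^m matters. Otherwise a is not
   a call, and p a^m leads to boundedly many configurations. *)
Lemma vpa_pump a b p r : (kind a = Call -> kind b = Call) ->
  (forall n, pda_language M (p ++ nseq n a ++ nseq n b ++ r)) ->
  exists m n, m <> n /\ pda_language M (p ++ nseq m a ++ nseq n b ++ r).
Proof.
(* The shift makes the block of b's longer than [r]; as it is positive, the run from [c k] makes a
   step, so the stack of [c k] is nonempty. *)
move=> ab Lab; pose N k := (k + (size r).+1)%N.
have /choice[c cP] k : exists c : pda_config M,
    (exists2 q0, q0 \in pda_init M &
      pda_run (q0, [:: pda_bot M]) (p ++ nseq (N k) a) c) /\
    exists2 q, q \in pda_final M & exists s,
      pda_run c (nseq (N k) b ++ r) (q, s).
  have [q0 [q [s [q0i qf]]]] := Lab (N k).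
  rewrite catA => /pda_run_cat[d d1 d2].
  by exists d; split; [exists q0|exists q => //; exists s].
suff [i [j [neij [q qf [s cs]]]]] : exists i j, i <> j /\
    exists2 q, q \in pda_final M & exists s,
      pda_run (c i) (nseq (N j) b ++ r) (q, s).
  exists (N i), (N j); split; first by move/addIn.
  have [[q0 q0i q0c] _] := cP i; exists q0, q, s; split=> //.
  by rewrite catA; apply/pda_run_cat; exists (c i).
have [ca|nca] := pselect (kind a = Call).
  have [i [j [ltij cij]]] := nat_fin_collision (fun k => (c k).1).
  exists i, j; split; first by move=> e; rewrite e ltnn in ltij.
  have [_ [qi' _ [si' ri]]] := cP i; have [_ [q qf [s rj]]] := cP j.
  exists q => //; move: cij ri rj.
  case: (c i) (c j) => [qi si] [qj sj] /= <- ri /pda_run_cat[[q1 s1]].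
  rewrite /N addnS => /(vpa_run_calls (ab ca))[u szu [-> uP]].
  case/pda_run_stack_prefix => [|u' u'P]; first by rewrite szu leqW ?leq_addl.
  exists (u' ++ si); apply/pda_run_cat; exists (q1, u ++ si); last exact: u'P.
  apply: uP; move: ri; rewrite /N addnS /=.
  by case=> d /pda_stepE[c0 [s' [_ [_ [-> _ _]]]]] _.
have szc k : (size (c k).2 <= (size p).+1)%N.
  have [[q0 _]] := cP k; case: (c k) => q s /pda_run_cat[[q1 s1] pq1].
  move=> /(vpa_run_size_noncall nca)/leq_trans-> //.
  exact: vpa_run_size pq1.
(* Stacks of bounded size form a finite type, and [szc] rules out the default value of
   [insub_bseq]. *)
have [i [j [ltij cij]]] := nat_fin_collision
  (fun k => ((c k).1, insub_bseq (size p).+1 (c k).2)).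
exists i, j; split; first by move=> e; rewrite e ltnn in ltij.
suff -> : c i = c j by case: (cP j).
case: cij (szc i) (szc j); rewrite /insub_bseq.
case: (c i) (c j) => [qi si] [qj sj] /= -> eqs szi szj; congr (_, _).
by have := congr1 val eqs; rewrite !insubdK.
Qed.

End Pumping.

(** * Reduced words and their suffixes *)

Section WordEval.
Variable X : choiceType.
Implicit Types (a b : letter X) (u v w : seq (letter X)) (g : free_group X).

Lemma word_eval_nil : word_eval [::] = 1 :> free_group X.
Proof. exact: big_nil. Qed.

Lemma word_eval_cons a w : word_eval (a :: w) = letter_eval a * word_eval w.
Proof. exact: big_cons. Qed.

Lemma word_eval_cat u v : word_eval (u ++ v) = word_eval u * word_eval v.
Proof. exact: big_cat. Qed.

Lemma word_eval_nseq n a : word_eval (nseq n a) = letter_eval a ^+ n.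
Proof.
elim: n => [|n IH]; first exact: word_eval_nil.
by rewrite word_eval_cons IH expgS.
Qed.

Lemma letter_evalV a : letter_eval (inv_letter a) = (letter_eval a)^-1.
Proof. by case: a => x [] //; rewrite /letter_eval /= invgK. Qed.

Lemma word_evalV w : word_eval (inv_word w) = (word_eval w)^-1.
Proof.
elim: w => [|a w IH]; first by rewrite word_eval_nil invg1.
rewrite /inv_word /= rev_cons -cats1 word_eval_cat IH.
by rewrite !word_eval_cons word_eval_nil mulg1 letter_evalV invgM.
Qed.

Lemma fg_word_eval w : fg_word (word_eval w) = reduce_cat w [::].
Proof.
elim: w => [|a w IH]; first by rewrite word_eval_nil.
by rewrite word_eval_cons /= IH; case: a => x [].
Qed.

Lemma fg_word_eval_reduced w : reduced w -> fg_word (word_eval w) = w.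
Proof. by move=> rw; rewrite fg_word_eval reduce_cats0. Qed.

Lemma fg_wordK : cancel (@fg_word X) (@word_eval X).
Proof. by move=> g; apply: val_inj; apply: fg_word_eval_reduced (fg_reduced g). Qed.

Lemma suffix_consE a w t : suffix t (a :: w) -> t = a :: w \/ suffix t w.
Proof.
case/suffixP=> -[|b u] /=; first by left.
by case=> _ ->; right; apply: suffix_suffix.
Qed.

Lemma suffix_reduce_cons a w t :
  suffix t (reduce_cons a w) -> t = reduce_cons a w \/ suffix t w.
Proof.
case: w => [|b w] /=; first exact: suffix_consE.
case: ifP => [_ tw|_]; last exact: suffix_consE.
by right; apply: suffix_trans tw (suffix_cons w b).
Qed.

(** The letters of [u] act from the right, each adding or deleting one first letter, so a suffix not
    inherited from [v] is an entire intermediate result. *)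
Lemma suffix_reduce_cat u v t : suffix t (reduce_cat u v) ->
  suffix t v \/ exists2 u', suffix u' u & t = reduce_cat u' v.
Proof.
elim: u => [|a u IH] /=; first by left.
case/suffix_reduce_cons=> [->|/IH[|[u' uu' ->]]]; [right|by left|right].
  by exists (a :: u); rewrite ?suffix_refl.
by exists u'; rewrite // (suffix_trans uu') ?suffix_cons.
Qed.

Lemma finite_suffixes w : finite_set [set t | suffix t w].
Proof.
apply: sub_finite_set (finite_image (fun i => drop i w) (finite_II (size w).+1)).
move=> t /suffixP[u ->]; exists (size u); last by rewrite drop_size_cat.
by rewrite /= ltnS size_cat leq_addr.
Qed.

(** The inverse of [u] is a prefix of [w], and [v] is the rest of [w]. *)
Lemma suffix_inv_word u w : suffix u (inv_word w) ->
  exists2 v, suffix v w & word_eval u = word_eval v / word_eval w.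
Proof.
case/suffixP=> v wE; exists (inv_word v).
  apply/suffixP; exists (inv_word u).
  by rewrite -[LHS]inv_wordK wE /inv_word map_cat rev_cat.
have: word_eval (inv_word w) = word_eval v * word_eval u.
  by rewrite wE word_eval_cat.
by rewrite !word_evalV => ->; rewrite mulKg.
Qed.

(** Each hypothesis guards one junction: the first a t, the second, after inversion, t^-1 a. *)
Lemma reduced_conj_power t a n :
  reduced (a :: t) -> reduced (inv_letter a :: t) ->
  reduced (inv_word t ++ nseq n.+1 a ++ t).
Proof.
move=> rat rVat; rewrite /reduced /= sorted_cat_cons; apply/andP; split.
  by have := reduced_inv rVat; rewrite /inv_word /= rev_cons inv_letterK.
elim: n => //= n ->; rewrite andbT.
by case: (a) => x b; rewrite /inv_letter xpair_eqE eqxx; case: b.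
Qed.

End WordEval.

(** * From finite orbits on cosets to finite index *)

Section FiniteIndex.
Variables (X : choiceType) (S : set (free_group X)).
Hypothesis SG : is_subgroup S.
Implicit Types (a : letter X) (t w : seq (letter X)) (g h : free_group X).

(** The elements of [S] whose suffixes all lie in [V] form a subgroup: a suffix of gh is one of h or
    lies in uS with u a suffix of g, and a suffix of g^-1 lies in vS with v a suffix of g. *)
Lemma suffix_in_cosets (gens V : set (free_group X)) :
  S = smallest (@is_subgroup _) gens -> V 1 ->
  (forall g h, V g -> S h -> V (g * h)) ->
  (forall g t, gens g -> suffix t (fg_word g) -> V (word_eval t)) ->
  forall g t, S g -> suffix t (fg_word g) -> V (word_eval t).
Proof.
case: (SG) => S1 SM SV SE V1 VS Vgens.
pose K : set (free_group X) :=
  [set g | S g /\ forall t, suffix t (fg_word g) -> V (word_eval t)].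
suff SK : S `<=` K by move=> g t /SK[_]; apply.
rewrite {1}SE; apply: smallest_sub; last first.
  move=> g gensg; split; last by move=> t; apply: Vgens.
  rewrite SE; exact: sub_gen_smallest.
split=> [|g h [Sg Vg] [Sh Vh]|g [Sg Vg]].
- by split=> // t; rewrite suffixs0 => /eqP->; rewrite word_eval_nil.
- split=> [|t /suffix_reduce_cat[/Vh//|[u /Vg Vu ->]]]; first exact: SM.
  have -> : word_eval (reduce_cat u (fg_word h)) = word_eval u * h.
    apply: val_inj; rewrite /= !fg_word_eval.
    by rewrite reduce_cats0 -?reduce_catA ?reduced_cat ?fg_reduced.
  exact: VS.
- split=> [|t /suffix_inv_word[u /Vg Vu ->]]; first exact: SV.
  by rewrite fg_wordK; apply: VS => //; apply: SV.
Qed.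

(** The second hypothesis says that a^n fixes the coset g^-1 S for some n > 0, that is, that this
    coset has a finite a-orbit. *)
Lemma periodic_finite_index : finitely_generated S ->
  (forall g a, exists2 n, (0 < n)%N & S (g * letter_eval a ^+ n / g)) ->
  finite_index S.
Proof.
move=> [gens fin_gens SE] per.
case: (SG) => S1 SM SV.
pose T : set (seq (letter X)) :=
  [set t | t = [::] \/ exists2 g, gens g & suffix t (fg_word g)].
pose V : set (free_group X) := [set g | exists2 t, T t & S ((word_eval t)^-1 * g)].
have VS g h : V g -> S h -> V (g * h).
  by move=> [t Tt Sg] Sh; exists t => //; rewrite mulgA; apply: SM.
have TV t : T t -> V (word_eval t) by move=> Tt; exists t; rewrite ?mulVg.
have Tsuf t u : suffix t u -> T u -> T t.
  move=> tu [u0|[g gensg ug]]; last first.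
    by right; exists g => //; apply: suffix_trans ug.
  by left; move: tu; rewrite u0 suffixs0 => /eqP.
have V1 : V 1 by rewrite -(@word_eval_nil X); apply: TV; left.
have SVsuf g t : S g -> suffix t (fg_word g) -> V (word_eval t).
  apply: (suffix_in_cosets SE) => // k u gensk uk.
  by apply: TV; right; exists k.
have Vper a t : reduced (a :: t) -> reduced (inv_letter a :: t) -> T t ->
    forall i, V (letter_eval a ^+ i * word_eval t).
  move=> rat rVat Tt; have [[|n] //= _] := per (word_eval t)^-1 a.
  rewrite invgK => Sn.
  have := @SVsuf (word_eval (inv_word t ++ nseq n.+1 a ++ t)).
  rewrite fg_word_eval_reduced ?reduced_conj_power //.
  rewrite !word_eval_cat word_evalV word_eval_nseq mulgA => /(_ _ Sn) Vn.
  (* For i at most n+1, a^i t is a suffix of the reduced word t^-1 a^(n+1) t in [S]. Larger i are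
     lowered by n+1, since a^(n+1) t lies in tS. *)
  elim/ltn_ind => i IH; have [ltni|lein] := ltnP n.+1 i.
    have -> : letter_eval a ^+ i * word_eval t =
        (letter_eval a ^+ (i - n.+1) * word_eval t) *
        ((word_eval t)^-1 * letter_eval a ^+ n.+1 * word_eval t).
      by rewrite !mulgA mulgK -expgnDr subnK // ltnW.
    by apply: VS => //; apply: IH; rewrite ltn_subrL (leq_trans _ ltni).
  rewrite -word_eval_nseq -word_eval_cat; apply: Vn.
  rewrite -(subnK lein) nseqD -catA catA; exact: suffix_suffix.
have Tred t : T t -> reduced t.
  by move=> [->//|[g _ tg]]; apply: suffix_sorted tg (fg_reduced g).
have Vpow a t i : T t -> V (letter_eval a ^+ i * word_eval t).
  (* A first letter a or a^-1 of the word is absorbed into the power, changing i by one; this is why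
     i is arbitrary in the induction. *)
  elim: t i => [|b t IH] i Tt; first exact: Vper.
  have Tt' := Tsuf _ _ (suffix_cons t b) Tt.
  have [eb|neb] := eqVneq b a.
    by rewrite word_eval_cons eb mulgA -expgSr; apply: IH.
  have [eVb|neVb] := eqVneq b (inv_letter a).
    case: i => [|i]; first by rewrite expg0 mul1g; apply: TV.
    by rewrite word_eval_cons eVb letter_evalV mulgA expgSr mulgK; apply: IH.
  have rbt : path (fun c d => d != inv_letter c) b t := Tred _ Tt.
  by apply: Vper; rewrite // /reduced /= rbt ?inv_letterK ?neb ?neVb.
have Vall g : V g.
  (* If w lies in tS, then aw lies in atS, which [Vpow] puts inside [V]. *)
  rewrite -[g]fg_wordK; elim: (fg_word g) => [|a w [t Tt Sw]].
    by rewrite word_eval_nil.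
  rewrite word_eval_cons.
  have := VS _ _ (Vpow a t 1%N Tt) Sw.
  by rewrite expg1 mulgA mulgK.
have finT : finite_set T.
  have -> : T = [set [::]] `|` \bigcup_(g in gens) [set t | suffix t (fg_word g)].
    by [].
  rewrite finite_setU; split; first exact: finite_set1.
  by apply: bigcup_finite => // g _; apply: finite_suffixes.
apply: sub_finite_set (finite_image (fun t => left_coset (word_eval t) S) finT).
move=> _ [g _ <-]; have [t Tt St] := Vall g; exists t => //.
rewrite predeqE => h; split=> -[s Ss <-].
  exists (g^-1 * word_eval t * s); last by rewrite !mulgA mulgV mul1g.
  by apply: SM => //; have := SV _ St; rewrite invgM invgK.
exists ((word_eval t)^-1 * g * s); last by rewrite !mulgA mulgV mul1g.
exact: SM.
Qed.

End FiniteIndex.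

(** * Automata for and from subgroups *)

Lemma regular_visibly_pushdown (A : Type) (L : language A) :
  regular L -> visibly_pushdown L.
Proof.
move=> [Q [q0 [F [delta LE]]]].
pose M := @Pda A Q unit tt [set q0]%SET F
  (fun q a c => [:: (delta q a, [:: c])]).
have runM q s w d :
    pda_run (M := M) (q, tt :: s) w d <-> d = (foldl delta q w, tt :: s).
  elim: w q => [|a w IH] q /=; first by split=> ->.
  rewrite -IH; split=> [[e ste]|rw]; last first.
    exists (delta q a, tt :: s) => //.
    have tr : (delta q a, [:: tt]) \in pda_trans (p := M) q a tt by rewrite inE.
    exact: (@PdaStep A M a q tt s (delta q a) [:: tt] tr).
  case: (pda_stepE (M := M) ste) => -[] [s' [q' [u [[<-]]]]].
  by rewrite inE => /eqP[-> ->] ->.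
exists (fun=> Internal), M; split=> [q a|]; first by exists [:: delta q a].
rewrite predeqE => w; rewrite LE; split=> [Fw|].
  by exists q0, (foldl delta q0 w), [:: tt]; split; rewrite ?inE //; apply/runM.
by move=> [_ [q [s [/set1P-> qF /runM[<- _]]]]].
Qed.

Section Recognisable.
Variable X : finType.
Implicit Types (S : set (free_group X)) (a : letter X) (g : free_group X).

Lemma vpl_forall_periodic S g a : is_subgroup S -> vpl_forall S ->
  exists2 n, (0 < n)%N & S (g * letter_eval a ^+ n / g).
Proof.
move=> [S1 SM SV] [kind [M [vpaM SE]]].
have SwE w : S (word_eval w) <-> pda_language M w by rewrite -SE.
have core b : (kind b = Call -> kind (inv_letter b) = Call) ->
    exists2 n, (0 < n)%N & S (g * letter_eval b ^+ n / g).
  move=> kb.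
  have bE m n : word_eval (fg_word g ++ nseq m b ++ nseq n (inv_letter b) ++
      inv_word (fg_word g)) = g * (letter_eval b ^+ m * letter_eval b ^- n) / g.
    rewrite !word_eval_cat !word_eval_nseq word_evalV fg_wordK letter_evalV.
    by rewrite expVgn !mulgA.
  have [n|m [n [nemn /SwE]]] := vpa_pump (p := fg_word g)
      (r := inv_word (fg_word g)) vpaM kb.
    by apply/SwE; rewrite bE !mulgV mulg1 mulgV.
  (* For m < n the power is negative, and the element of [S] is inverted. *)
  rewrite bE; case: (ltngtP m n) => [ltmn|ltnm|//] Smn.
    exists (n - m)%N; first by rewrite subn_gt0.
    have := SV _ Smn; rewrite !invgM !invgK -!mulgA.
    by rewrite expgnFr ?(ltnW ltmn) // !mulgA.
  exists (m - n)%N; first by rewrite subn_gt0.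
  by rewrite expgnFr // ltnW.
(* If the condition fails for a, then a^-1 is not a call, so its inverse satisfies the condition; a
   power of a^-1 is then inverted. *)
have [ka|ka] := pselect (kind a = Call -> kind (inv_letter a) = Call).
  exact: core.
have [|n n0 Sn] := core (inv_letter a).
  by rewrite inv_letterK => ?; apply: contrapT => ?; apply: ka.
exists n => //; have := SV _ Sn.
by rewrite letter_evalV expVgn !invgM !invgK mulgA.
Qed.

(* The state reached on w is the left coset of the inverse of w, since words are
   read from left to right. *)
Lemma finite_index_recognisable S : is_subgroup S -> finite_index S ->
  recognisable S.
Proof.
move=> [S1 SM SV] /finite_seqP[cs csE].
have csP g : left_coset g S \in cs.
  by have : [set` cs] (left_coset g S) by rewrite -csE; exists g.
have cosetP g h : left_coset g S = left_coset h S <-> S (g^-1 * h).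
  split=> [E|Sgh].
    have : left_coset g S h by rewrite E; exists 1; rewrite ?mulg1.
    by case=> s Ss <-; rewrite mulKg.
  rewrite predeqE => k; split=> -[s Ss <-].
    exists ((g^-1 * h)^-1 * s); first by apply: SM => //; apply: SV.
    by rewrite invgM invgK -!mulgA mulVKg.
  by exists (g^-1 * h * s); [apply: SM|rewrite -mulgA mulVKg -?mulgA].
pose st g : seq_sub cs := SeqSub (csP g).
have /choice[rep repP] (i : seq_sub cs) : exists g, st g = i.
  have : [set` cs] (val i) by apply: (valP i).
  by rewrite -csE => -[g _ gE]; exists g; apply: val_inj.
have stP g h : st g = st h <-> S (g^-1 * h).
  by rewrite -cosetP; split=> [/(congr1 val)|E] //; apply: val_inj.
exists (seq_sub cs), (st 1), [set i | `[<S (rep i)>]]%SET.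
(* Left multiplication permutes left cosets, so the chosen representative does not affect the next
   state. *)
exists (fun i a => st ((letter_eval a)^-1 * rep i)) => w.
have -> v : foldl (fun i a => st ((letter_eval a)^-1 * rep i)) (st v) w =
    st ((word_eval w)^-1 * v).
  elim: w v => [|a w IH] v /=; first by rewrite word_eval_nil invg1 mul1g.
  rewrite IH word_eval_cons invgM -mulgA; apply/stP.
  rewrite !invgM !invgK -!mulgA mulVKg mulVKg.
  by apply/stP; rewrite repP.
rewrite mulg1 inE asboolE /=.
(* The representative h lies in w^-1 S, hence it is in [S] exactly when w is. *)
have /stP := repP (st (word_eval w)^-1); set h := rep _ => Sh.
split=> Sw.
  by have := SV _ (SM _ _ Sh Sw); rewrite -mulgA mulVg mulg1 invgK.
by have := SV _ (SM _ _ Sw Sh); rewrite mulVKg invgK.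
Qed.

End Recognisable.

Theorem theorem3 (X : finType) (S : set (free_group X)) :
  is_subgroup S -> finitely_generated S ->
  (vpl_forall S <-> finite_index S) /\ (finite_index S -> recognisable S).
Proof.
move=> SG Sfg; have rec := @finite_index_recognisable X S SG.
split=> //; split=> [vplS|/rec]; last exact: regular_visibly_pushdown.
by apply: periodic_finite_index => // g a; apply: vpl_forall_periodic.
Qed.
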